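(* Let $f:\mathbb X\to\mathbb Y$ be a mapping between normed spaces, let $\bar x\in\mathbb X$ and $\epsilon>0$. Suppose that $f$ admits an outer $\epsilon$-prederivative $\mathcal A:\mathbb X\rightrightarrows\mathbb Y$ at $\bar x$ such that $\alpha(\mathcal A)>\epsilon$. Then $f$ is strongly metrically subregular at $\bar x$ and $$\mathrm{subreg}\,f(\bar x)\le\frac{1}{\alpha(\mathcal A)-\epsilon}.$$ If, in particular, $\mathcal A$ is an outer prederivative of $f$ at $\bar x$, then the stricter estimate $$\mathrm{subreg}\,f(\bar x)\le\frac{1}{\alpha(\mathcal A)}$$ holds.
   Context: $B(x,r)$ denotes the closed ball with center $x$ and radius $r$, $\mathbb B$ the closed unit ball of a normed space, $\mathbf 0$ the null vector, and $\mathrm{dist}(x,S)=\inf_{s\in S}\|x-s\|$, with $\mathrm{dist}(x,\varnothing)=+\infty$. A set-valued mapping $\mathcal A:\mathbb X\rightrightarrows\mathbb Y$ is positively homogeneous if $\mathbf 0\in\mathcal A(\mathbf 0)$ and $\mathcal A(tx)=t\mathcal A(x)$ for all $x\in\mathbb X$ and $t>0$. For such $\mathcal A$, $\alpha(\mathcal A)=\inf_{\|u\|=1}\mathrm{dist}(\mathbf 0,\mathcal A(u))$. Given $\epsilon>0$, a positively homogeneous $\mathcal A$ is an outer (Fréchet) $\epsilon$-prederivative of $f$ at $\bar x$ if there exist $\delta>0$ and a function $r:\delta\mathbb B\to[0,\epsilon]$ such that $$f(\bar x+v)-f(\bar x)\in\mathcal A(v)+r(v)\|v\|\mathbb B,\quad\forall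 v\in\delta\mathbb B.$$ It is an outer prederivative of $f$ at $\bar x$ if this holds with a function $r:\delta\mathbb B\to[0,\epsilon]$ such that, moreover, $\lim_{v\to\mathbf 0}r(v)=0$. A mapping $f:\mathbb X\to\mathbb Y$ is metrically subregular at $\bar x$ if there exist $\kappa\ge 0$ and $r>0$ such that $\mathrm{dist}(x,f^{-1}(f(\bar x)))\le\kappa\|f(x)-f(\bar x)\|$ for all $x\in B(\bar x,r)$; the modulus $\mathrm{subreg}\,f(\bar x)$ is the infimum of all $\kappa\ge 0$ for which such an $r$ exists. It is strongly metrically subregular at $\bar x$ if, in addition, $\bar x$ is an isolated point of $f^{-1}(f(\bar x))$; equivalently, if there exist $\kappa\ge0$, $r>0$ with $\|x-\bar x\|\le\kappa\|f(x)-f(\bar x)\|$ for all $x\in B(\bar x,r)$. *)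

(* Defs.v *)
From HB Require Import structures.
From mathcomp Require Import all_boot all_order all_algebra.
From mathcomp Require Import all_classical all_reals all_analysis.
Export numFieldNormedType.Exports.

Set Implicit Arguments.
Unset Strict Implicit.
Unset Printing Implicit Defensive.

Import Order.TTheory GRing.Theory Num.Theory.

Local Open Scope classical_set_scope.
Local Open Scope ring_scope.

(* A set-valued mapping is a function [A : X -> set Y], whose values may be
   empty. *)

(* [ereal_inf set0 = +oo], so the distance to the empty set is +oo. *)
Definition dist (R : realType) (X : normedModType R) (x : X) (S : set X) :
    \bar R :=
  ereal_inf [set (`|x - s|)%:E | s in S].

Definition cball (R : realType) (X : normedModType R) (x : X) (r : R) : set X :=
  closed_ball_ (fun z : X => `|z|) x r.

Definition positively_homogeneous (R : realType) (X Y : normedModType R)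
    (A : X -> set Y) : Prop :=
  A 0 0 /\
  forall (x : X) (t : R), 0 < t -> A (t *: x) = [set t *: y | y in A x].

(* Equal to +oo when X is the null space, or when A is empty-valued on the
   whole unit sphere. *)
Definition alpha (R : realType) (X Y : normedModType R) (A : X -> set Y) :
    \bar R :=
  ereal_inf [set dist 0 (A u) | u in [set u : X | `|u| = 1]].

(* The remainder is a total function [r : X -> R], of which only the values on
   the closed ball of radius [delta] are constrained; the image set is the
   Minkowski sum of [A v] and of the unit ball scaled by [r v * `|v|]. *)
Definition prederivative_remainder (R : realType) (X Y : normedModType R)
    (eps : R) (A : X -> set Y) (f : X -> Y) (xbar : X) (delta : R)
    (r : X -> R) : Prop :=
  forall v : X, cball 0 delta v ->
    0 <= r v <= eps /\
    [set y + (r v * `|v|) *: b | y in A v & b in cball (0 : Y) 1]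
      (f (xbar + v) - f xbar).

Definition outer_eps_prederivative (R : realType) (X Y : normedModType R)
    (eps : R) (A : X -> set Y) (f : X -> Y) (xbar : X) : Prop :=
  positively_homogeneous A /\
  exists (delta : R) (r : X -> R),
    0 < delta /\ prederivative_remainder eps A f xbar delta r.

(* Since r tends to 0, this does not depend on [eps > 0], up to shrinking
   [delta]. *)
Definition outer_prederivative (R : realType) (X Y : normedModType R)
    (eps : R) (A : X -> set Y) (f : X -> Y) (xbar : X) : Prop :=
  positively_homogeneous A /\
  exists (delta : R) (r : X -> R),
    [/\ 0 < delta, prederivative_remainder eps A f xbar delta r
      & r v @[v --> (0 : X)^'] --> (0 : R)].

Definition subreg_const (R : realType) (X Y : normedModType R) (f : X -> Y)
    (xbar : X) (kappa : R) : Prop :=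
  0 <= kappa /\
  exists2 r : R, 0 < r &
    forall x : X, cball xbar r x ->
      (dist x (f @^-1` [set f xbar]) <= (kappa * `|f x - f xbar|)%:E)%E.

Definition metrically_subregular (R : realType) (X Y : normedModType R)
    (f : X -> Y) (xbar : X) : Prop :=
  exists kappa : R, subreg_const f xbar kappa.

Definition subreg (R : realType) (X Y : normedModType R) (f : X -> Y)
    (xbar : X) : \bar R :=
  ereal_inf [set kappa%:E | kappa in subreg_const f xbar].

Definition strongly_metrically_subregular (R : realType)
    (X Y : normedModType R) (f : X -> Y) (xbar : X) : Prop :=
  metrically_subregular f xbar /\ isolated (f @^-1` [set f xbar]) xbar.

(* Main.v *)
Require Import Defs.
From HB Require Import structures.
From mathcomp Require Import all_boot all_order all_algebra.
From mathcomp Require Import all_classical all_reals all_analysis.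

(** Write [a] for [alpha A].  By positive homogeneity, every element of [A v]
    has norm at least [a * `|v|]: rescale [v] to the unit sphere
    ([alpha_le_norm]).  If [f (xbar + v) - f xbar] differs from an element of
    [A v] by at most [s * `|v|], the triangle inequality then gives the linear
    growth [(a - s) * `|v| <= `|f (xbar + v) - f xbar|] ([remainder_growth]).
    Growth with a constant [c > 0] near [xbar] keeps the other solutions of
    [f x = f xbar] away from [xbar], and bounds the distance from [x] to the
    solution set, which is at most [`|x - xbar|], by [c^-1 * `|f x - f xbar|]:
    hence strong subregularity with modulus at most [c^-1]
    ([growth_subreg_const], [growth_isolated]).

    For an outer [eps]-prederivative one takes [s = eps], so every [c] below
    [a - eps] is a growth constant; for an outer prederivative [s] may be any
    positive number, so every [c] below [a] is one.  The infimum of the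
    corresponding [c^-1] is the announced bound ([le_inve_of_lt]).  Approaching
    the bound through real [c] also covers [a = +oo], where the bound is [0]. *)

Section SubregularityFromGrowth.
Set Implicit Arguments.
Unset Strict Implicit.
Import Order.TTheory GRing.Theory Num.Theory.
Local Open Scope classical_set_scope.
Local Open Scope ring_scope.

Lemma lt_EFin_between (R : realType) (x : R) (a : \bar R) :
  (x%:E < a)%E -> exists2 y : R, x < y & (y%:E < a)%E.
Proof.
case: a => [a|_|//]; last by exists (x + 1); rewrite ?ltrDl ?ltry.
by rewrite lte_fin => xa; exists ((x + a) / 2); rewrite ?lte_fin ?midf_lt.
Qed.

(** A margin [e > 0] above [a^-1] leaves room for the real number
    [c = (a^-1 + e)^-1] below [a], even if [a = +oo], whose inverse is [0]. *)
Lemma le_inve_of_lt (R : realType) (a s : \bar R) :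
  (0 < a)%E -> (forall c : R, 0 < c -> (c%:E < a)%E -> (s <= (c^-1)%:E)%E) ->
  (s <= a^-1)%E.
Proof.
case: a => [a|_ H|//].
- rewrite lte_fin => a0 H; rewrite inver gt_eqF//; apply/lee_addgt0Pr => e e0.
  have ae0 : 0 < a^-1 + e by rewrite addr_gt0 ?invr_gt0.
  have := H (a^-1 + e)^-1; rewrite invrK -EFinD; apply; first by rewrite invr_gt0.
  by rewrite lte_fin invf_plt ?posrE// ltrDl.
- rewrite invey; apply/lee_addgt0Pr => e e0; rewrite add0e.
  by have := H e^-1; rewrite invrK; apply; rewrite ?invr_gt0 ?ltry.
Qed.

Lemma cball0E (R : realType) (X : normedModType R) (r : R) (v : X) :
  cball 0 r v = (`|v| <= r) :> Prop.
Proof. by rewrite /cball /closed_ball_ /= sub0r normrN. Qed.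

Section Growth.
Context (R : realType) (X Y : normedModType R) (f : X -> Y) (xbar : X).

Lemma growth_subreg_const (c : R) : 0 < c ->
  (\forall v \near (0 : X), c * `|v| <= `|f (xbar + v) - f xbar|) ->
  subreg_const f xbar c^-1.
Proof.
move=> c0 /nbhs_normP[r /= r0 growth]; split; first by rewrite invr_ge0 ltW.
(* half the radius, since the neighbourhood is an open ball *)
exists (r / 2); first by rewrite divr_gt0.
move=> x; rewrite /cball /closed_ball_ /= distrC => xr.
apply: (@le_trans _ _ (`|x - xbar|)%:E).
  by apply: ereal_inf_lbound; exists xbar.
rewrite lee_fin ler_pdivlMl//.
have := growth (x - xbar); rewrite /ball_ /= sub0r normrN [xbar + _]addrC subrK; apply.
by rewrite (le_lt_trans xr)// ltr_pdivrMr// ltr_pMr// ltr1n.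
Qed.

Lemma growth_isolated (c : R) : 0 < c ->
  (\forall v \near (0 : X), c * `|v| <= `|f (xbar + v) - f xbar|) ->
  isolated (f @^-1` [set f xbar]) xbar.
Proof.
move=> c0 growth; split; first by rewrite inE.
exists [set x | c * `|x - xbar| <= `|f x - f xbar|].
  apply/nbhs0P; apply: filterS growth => v /=.
  by rewrite [xbar + v - xbar]addrAC subrr add0r.
apply/seteqP; split => x /=.
  move=> [le_x fx]; move: le_x; rewrite fx subrr normr0 pmulr_rle0//.
  by rewrite normr_le0 subr_eq0 => /eqP.
by move=> ->; rewrite !subrr !normr0 mulr0.
Qed.

(** The infimum defining [alpha A] only sees unit vectors; for nonzero [v],
    the set [A v] is [A (`|v|^-1 *: v)] scaled by [`|v|]. *)
Lemma alpha_le_norm (A : X -> set Y) (m : R) (v : X) (y : Y) :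
  positively_homogeneous A -> (m%:E <= alpha A)%E -> A v y ->
  m * `|v| <= `|y|.
Proof.
move=> [_ hom] mA Avy; have [->|v0] := eqVneq v 0; first by rewrite normr0 mulr0.
have nv : 0 < `|v| by rewrite normr_gt0.
move: Avy; rewrite -[v in A v](@scalerKV _ _ `|v|) ?gt_eqF// hom// => -[z Az <-].
rewrite normrZ normr_id mulrC ler_pM2l//.
rewrite -lee_fin (le_trans mA)//; apply: (@le_trans _ _ (dist 0 (A (`|v|^-1 *: v)))).
  apply: ereal_inf_lbound; exists (`|v|^-1 *: v) => //=.
  by rewrite normrZ normfV normr_id mulVf ?gt_eqF.
by apply: ereal_inf_lbound; exists z => //; rewrite sub0r normrN.
Qed.

(** The increment of [f] is within [s * `|v|] of a point of norm at least
    [m * `|v|]. *)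
Lemma remainder_growth (eps delta s m : R) (A : X -> set Y) (r : X -> R) (v : X) :
  positively_homogeneous A -> (m%:E <= alpha A)%E ->
  prederivative_remainder eps A f xbar delta r ->
  `|v| <= delta -> r v <= s ->
  (m - s) * `|v| <= `|f (xbar + v) - f xbar|.
Proof.
move=> homA mA rem vd rs.
have [|/andP[r0 _] [y Avy [b + <-]]] := rem v; first by rewrite cball0E.
rewrite cball0E => b1.
apply: le_trans (lerB_normD _ _); rewrite mulrBl lerB//.
  exact: alpha_le_norm Avy.
rewrite normrZ ger0_norm ?mulr_ge0//.
by rewrite (le_trans (ler_piMr _ b1)) ?mulr_ge0// ler_wpM2r.
Qed.

Lemma outer_eps_growth (eps m : R) (A : X -> set Y) :
  outer_eps_prederivative eps A f xbar -> (m%:E <= alpha A)%E ->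
  \forall v \near (0 : X), (m - eps) * `|v| <= `|f (xbar + v) - f xbar|.
Proof.
move=> [homA [delta [r [d0 rem]]]] mA.
apply: filterS (nbhs0_le d0) => v vd.
apply: (remainder_growth homA mA rem vd).
by have [|/andP[]] := rem v; rewrite ?cball0E.
Qed.

Lemma outer_growth (eps s m : R) (A : X -> set Y) :
  outer_prederivative eps A f xbar -> (m%:E <= alpha A)%E -> 0 < s ->
  \forall v \near (0 : X), (m - s) * `|v| <= `|f (xbar + v) - f xbar|.
Proof.
move=> [homA [delta [r [d0 rem r_cvg]]]] mA s0.
have /cvgr0Pnorm_le/(_ _ s0) rs := r_cvg.
apply: filterS2 (nbhs0_le d0) rs => v vd rvs.
(* the limit says nothing about [r 0] *)
have [->|v0] := eqVneq v 0; first by rewrite normr0 mulr0.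
by apply: (remainder_growth homA mA rem vd); rewrite (le_trans (ler_norm _)) ?rvs.
Qed.

End Growth.
End SubregularityFromGrowth.

Local Open Scope ring_scope.
Local Open Scope ereal_scope.

Theorem theorem5 (R : realType) (X Y : normedModType R) (f : X -> Y) (xbar : X)
    (eps : R) (heps : (0 < eps)%R) (A : X -> set Y)
    (hA : outer_eps_prederivative eps A f xbar)
    (halpha : eps%:E < alpha A) :
  [/\ strongly_metrically_subregular f xbar,
      subreg f xbar <= (alpha A - eps%:E)^-1
    & outer_prederivative eps A f xbar -> subreg f xbar <= (alpha A)^-1].
Proof.
have alpha_gt0 : 0 < alpha A by apply: Order.POrderTheory.lt_trans halpha; rewrite lte_fin.
have gap_gt0 : 0 < alpha A - eps%:E by rewrite sube_gt0.
have growth_eps (c : R) : c%:E < alpha A - eps%:E ->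
    \forall v \near (0%R : X), (c * `|v| <= `|f (xbar + v) - f xbar|)%R.
  rewrite lteBrDr// -EFinD => /Order.POrderTheory.ltW ceA.
  by have := outer_eps_growth hA ceA; rewrite GRing.addrK.
split.
- have [c c_gt0 cA] := lt_EFin_between gap_gt0.
  split; last exact: growth_isolated c_gt0 (growth_eps c cA).
  by exists c^-1%R; exact: growth_subreg_const c_gt0 (growth_eps c cA).
- apply: le_inve_of_lt => // c c_gt0 cA; apply: ereal_inf_lbound.
  by exists c^-1%R => //; exact: growth_subreg_const c_gt0 (growth_eps c cA).
- move=> hA0; apply: le_inve_of_lt => // c c_gt0 cA; apply: ereal_inf_lbound.
  exists c^-1%R => //; apply: growth_subreg_const => //.
  have [m cm /Order.POrderTheory.ltW mA] := lt_EFin_between cA.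
  have mc_gt0 : (0 < m - c)%R by rewrite Num.Theory.subr_gt0.
  (* [c = m - s], where [s = m - c > 0] is the admissible size of the remainder *)
  by have := outer_growth hA0 mA mc_gt0; rewrite GRing.subKr.
Qed.
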